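(* For all integers $n\ge 0$, $$\sum_{k=0}^{n}\binom{n}{k}2^k\phi_k(x)\phi_{n-k}(-x)=\sum_{k=0}^{n}(-1)^{n-k}{n \brace k}L_k(x).$$
   Context: All identities are between polynomials in an indeterminate $x$ with real coefficients. For $n\ge 0$, $J_n(x)=n!\sum_{k=0}^{n}\binom{n+k}{n-k}\frac{x^k}{k!}$. The polynomials $L_n(x)$ are defined by $L_n(x)=J_n(x)-nJ_{n-1}(x)$ for $n\ge 0$, where for $n=0$ the second term is read as $0$, so $L_0(x)=1$. ${n \brace k}$ denotes the Stirling numbers of the second kind, given by $\frac{1}{k!}(e^t-1)^k=\sum_{n=k}^{\infty}{n \brace k}\frac{t^n}{n!}$. The Bell polynomials are $\phi_n(x)=\sum_{k=0}^{n}{n \brace k}x^k$, $n\ge 0$. *)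

(* Defs.v *)
From mathcomp Require Import all_boot all_order all_algebra.
From mathcomp Require Import reals.

Set Implicit Arguments.
Unset Strict Implicit.
Unset Printing Implicit Defensive.

Import Order.TTheory GRing.Theory Num.Theory.
Local Open Scope ring_scope.

Section Definitions.
Variable R : numFieldType.

(* A formal power series \sum_n (f n) t^n is its coefficient sequence f. *)
Definition fps_one : nat -> R := fun n => (n == 0%N)%:R.

Definition fps_mul (f g : nat -> R) : nat -> R :=
  fun n => \sum_(i < n.+1) f i * g (n - i)%N.

Definition fps_pow (f : nat -> R) (k : nat) : nat -> R :=
  iter k (fps_mul f) fps_one.

Definition fps_scale (c : R) (f : nat -> R) : nat -> R := fun n => c * f n.

Definition fps_sub (f g : nat -> R) : nat -> R := fun n => f n - g n.

Definition fps_et : nat -> R := fun n => (n`!%:R)^-1.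

(* The coefficient of t^n / n! in (e^t - 1)^k / k!. *)
Definition stirling2 (n k : nat) : R :=
  n`!%:R * fps_scale (k`!%:R)^-1 (fps_pow (fps_sub fps_et fps_one) k) n.

Definition bell_poly (n : nat) : {poly R} :=
  \sum_(k < n.+1) stirling2 n k *: 'X^k.

Definition J_poly (n : nat) : {poly R} :=
  n`!%:R *: \sum_(k < n.+1) ('C(n + k, n - k)%:R / k`!%:R) *: 'X^k.

(* At n = 0 the second term vanishes because of its factor n. *)
Definition L_poly (n : nat) : {poly R} := J_poly n - n%:R *: J_poly n.-1.

End Definitions.

(* Main.v *)
Require Import Defs.
From HB Require Import structures.
From mathcomp Require Import all_boot all_order all_algebra.
From mathcomp Require Import reals.
From mathcomp Require Import ring zify.

Import Order.TTheory GRing.Theory Num.Theory.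
Local Open Scope ring_scope.

(** Exponential generating functions explain the identity. Since the Bell
    polynomials have generating function exp(x(e^t - 1)), the left side is
    generated by
      exp(x(e^(2t) - 1)) exp(-x(e^t - 1)) = exp(x(e^(2t) - e^t)).
    Since \sum_k L_k u^k / k! = exp(x u / (1 - u)^2), and the numbers
    (-1)^(n-k) S(n, k) are generated by (1 - e^(-t))^k / k!, the right side has
    generating function exp(x u / (1 - u)^2) with u = 1 - e^(-t). For this u,
    u / (1 - u)^2 = e^(2t) - e^t. Hence the coefficient of x^j on both sides is
    1/j! times n! [t^n] (e^(2t) - e^t)^j.

    To avoid composing power series, every series in t is written as
    e^(ct) p(e^t) with p a polynomial, and only the linear functional
      moment c n p = n! [t^n] e^(ct) p(e^t) = \sum_i p_i (c + i)^n
    is used. Multiplication of series becomes [momentM], the Stirling numbers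
    are the moments of (X - 1)^k / k! ([stirling2_moment]), and the left side
    follows from the binomial theorem ([lhs_coef]). For the right side the
    series u^j / (1 - u)^(2j) is truncated at order n. With X standing for
    e^(-t) and u = 1 - X, the truncation times X^(2j) is u^j modulo u^(n+1)
    ([neg_bin_dvdp]). The error is harmless because moments of order n vanish on
    multiples of u^(n+1) ([moment_eq0]), and the division by X^(2j) becomes a
    change of c ([momentXnM]). Finally [moment_reflect] turns t into -t. *)

(** * Moments of polynomials in e^t *)

Section Moments.
Set Implicit Arguments.
Unset Strict Implicit.

Variable R : numFieldType.
Implicit Types (c d : R) (n m j k : nat) (p q : {poly R}).

Definition moment c n p : R := \sum_(i < size p) p`_i * (c + i%:R) ^+ n.

Lemma moment_widen c n p m : (size p <= m)%N ->
  moment c n p = \sum_(i < m) p`_i * (c + i%:R) ^+ n.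
Proof.
move=> pm; rewrite /moment (big_ord_widen m (fun i => p`_i * (c + i%:R) ^+ n)) //.
rewrite big_mkcond; apply: eq_bigr => i _; case: ltnP => // h.
by rewrite nth_default // mul0r.
Qed.

Lemma moment_is_scalar c n : scalar (moment c n).
Proof.
move=> a p q; set m := maxn (size p) (size q).
have hs : (size (a *: p + q)%R <= m)%N.
  apply: leq_trans (size_polyD _ _) _.
  by rewrite geq_max leq_maxr andbT (leq_trans (size_scale_leq _ _)) ?leq_maxl.
rewrite (moment_widen _ _ hs) (@moment_widen _ _ p m) ?leq_maxl //.
rewrite (@moment_widen _ _ q m) ?leq_maxr // mulr_sumr -big_split /=.
by apply: eq_bigr => i _; rewrite coefD coefZ; ring.
Qed.

HB.instance Definition _ c n :=
  GRing.isLinear.Build R {poly R} R *%R (moment c n) (moment_is_scalar c n).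

Lemma momentZ c n a p : moment c n (a *: p) = a * moment c n p.
Proof. exact: linearZ. Qed.

Lemma moment_signM c n k p :
  moment c n ((-1) ^+ k * p) = (-1) ^+ k * moment c n p.
Proof. by rewrite -momentZ -mul_polyC rmorphXn rmorphN1. Qed.

Lemma momentXM c n p : moment c n ('X * p) = moment (c + 1) n p.
Proof.
rewrite (@moment_widen _ _ _ (size p).+1); last first.
  by rewrite (leq_trans (size_polyMleq _ _)) // size_polyX.
rewrite big_ord_recl coefXM mul0r add0r; apply: eq_bigr => i _.
by rewrite coefXM /= -addrA -natr1 [i%:R + 1]addrC.
Qed.

Lemma momentXnM c n m p : moment c n ('X^m * p) = moment (c + m%:R) n p.
Proof.
elim: m c => [|m IH] c; first by rewrite mul1r addr0.
by rewrite exprS -mulrA momentXM IH -addrA -natr1 [1 + _]addrC.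
Qed.

Lemma momentC c n a : moment c n a%:P = a * c ^+ n.
Proof.
by rewrite (@moment_widen _ _ _ 1) ?size_polyC_leq1 // big_ord1 coefC addr0.
Qed.

(** Factoring e^((c+d)t) q(e^t) as e^(dt) q(e^t) times e^(ct). *)
Lemma moment_shift c d n q :
  moment (c + d) n q = \sum_(k < n.+1) 'C(n, k)%:R * c ^+ k * moment d (n - k) q.
Proof.
transitivity (\sum_(i < size q) \sum_(k < n.+1)
    'C(n, k)%:R * c ^+ k * (q`_i * (d + i%:R) ^+ (n - k))).
  apply: eq_bigr => i _; rewrite -addrA [c + _]addrC exprDn mulr_sumr.
  by apply: eq_bigr => k _; rewrite -mulr_natl; ring.
by rewrite exchange_big; apply: eq_bigr => k _; rewrite -mulr_sumr.
Qed.

(** The Leibniz rule for the n-th derivative at t = 0 of a product of series. *)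
Lemma momentM c d n p q : moment (c + d) n (p * q) =
  \sum_(k < n.+1) 'C(n, k)%:R * moment c k p * moment d (n - k) q.
Proof.
elim/poly_ind: p c => [|p a IH] c.
  by rewrite mul0r raddf0 big1 // => k _; rewrite raddf0 mulr0 mul0r.
rewrite mulrDl commr_polyX -mulrA raddfD /= momentXM addrAC IH mul_polyC.
rewrite momentZ moment_shift mulr_sumr -big_split.
by apply: eq_bigr => k _ /=; rewrite raddfD /= momentXM momentC; ring.
Qed.

(** The series (e^t - 1)^a has order a in t. *)
Lemma moment_eq0 c n a p : (n < a)%N -> moment c n (('X - 1) ^+ a * p) = 0.
Proof.
elim: a n c => [//|a IH] n c; rewrite ltnS => na.
rewrite exprS -mulrA mulrBl mul1r raddfB /= momentXM (addrC c) moment_shift.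
rewrite big_ord_recl bin0 expr0 !mul1r subn0 addrC addKr.
apply: big1 => k _ /=; rewrite IH ?mulr0 //; have := ltn_ord k.
by rewrite /bump; lia.
Qed.

(** Substituting X^2 for X replaces t by 2t. *)
Lemma moment_comp_sqr n p : moment 0 n (p \Po 'X^2) = 2 ^+ n * moment 0 n p.
Proof.
suff H c : moment (2 * c) n (p \Po 'X^2) = 2 ^+ n * moment c n p.
  by rewrite -H mulr0.
elim/poly_ind: p c => [|p a IH] c; first by rewrite linear0 !raddf0 mulr0.
rewrite comp_polyD comp_polyM comp_polyX comp_polyC commr_polyXn commr_polyX.
rewrite !raddfD /= momentXnM momentXM !momentC.
rewrite (_ : 2 * c + 2 = 2 * (c + 1)); last by ring.
by rewrite IH exprMn; ring.
Qed.

(** This is e^(-ct) (1 - e^(-t))^j = e^(-(c+j)t) (e^t - 1)^j: replacing t by -t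
    multiplies the n-th moment by (-1)^n. *)
Lemma moment_reflect c n j :
  (-1) ^+ n * moment c n ((1 - 'X) ^+ j) = moment (- c - j%:R) n (('X - 1) ^+ j).
Proof.
elim: j c => [|j IH] c.
  by rewrite !expr0 !momentC subr0 !mul1r -exprMn mulN1r.
rewrite !exprS !mulrBl !mul1r !raddfB /= !momentXM mulrBr !IH.
by congr (moment _ _ _ - moment _ _ _); rewrite -natr1; ring.
Qed.

Lemma fps_pow_moment n k :
  fps_pow (fps_sub (fps_et R) (fps_one R)) k n
  = moment 0 n (('X - 1) ^+ k) / n`!%:R.
Proof.
elim: k n => [|k IH] n.
  by rewrite expr0 momentC expr0n /= /fps_one; case: n => [|n];
    rewrite ?divr1 ?mul1r ?mul0r ?fact0 ?invr1.
rewrite exprS -[0 in RHS](addr0 0) momentM mulr_suml /= /fps_mul.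
apply: eq_bigr => i _; rewrite IH -/(fps_pow _ _).
have -> : fps_sub (fps_et R) (fps_one R) i = moment 0 i ('X - 1) / i`!%:R.
  rewrite -['X]mulr1 raddfB /= momentXM !momentC add0r !mul1r expr1n expr0n.
  by rewrite /fps_sub /fps_et /fps_one; case: (i : nat) => [|j];
    rewrite ?fact0 ?invr1 ?mulr1 ?subr0 ?mul1r.
have -> : n`!%:R = 'C(n, i)%:R * i`!%:R * (n - i)`!%:R :> R.
  by rewrite -!natrM -mulnA bin_fact // -ltnS.
have F m : m`!%:R != 0 :> R by rewrite pnatr_eq0 -lt0n fact_gt0.
have B : 'C(n, i)%:R != 0 :> R by rewrite pnatr_eq0 -lt0n bin_gt0 -ltnS.
by field; rewrite B !F.
Qed.

Lemma stirling2_moment n k :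
  stirling2 R n k = moment 0 n (('X - 1) ^+ k) / k`!%:R.
Proof.
rewrite /stirling2 /fps_scale fps_pow_moment mulrCA mulrC; congr (_ / _).
by rewrite mulrC divfK // pnatr_eq0 -lt0n fact_gt0.
Qed.

(** * The left side *)

Lemma coef_bell_poly n j : (bell_poly R n)`_j = stirling2 R n j.
Proof.
rewrite /bell_poly -(poly_def n.+1) coef_poly; case: ltnP => // nj.
by rewrite stirling2_moment -[_ ^+ _]mulr1 moment_eq0 // mul0r.
Qed.

Lemma coef_comp_polyN p j : (p \Po (- 'X))`_j = (-1) ^+ j * p`_j.
Proof.
elim/poly_ind: p j => [|p a IH] j; first by rewrite linear0 !coef0 mulr0.
rewrite comp_polyD comp_polyM comp_polyX comp_polyC mulrN !coefD coefN !coefMX.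
rewrite !coefC; case: j => [|j] /=; first by rewrite oppr0 mul1r.
by rewrite IH exprS; ring.
Qed.

(** The exponents of the two factors add up to
    x(e^(2t) - 1) - x(e^t - 1) = x(e^(2t) - e^t). *)
Lemma lhs_coef n j :
  (\sum_(k < n.+1) ('C(n, k)%:R * 2 ^+ k) *:
     (bell_poly R k * (bell_poly R (n - k) \Po (- 'X))))`_j
  = moment 0 n (('X^2 - 'X) ^+ j) / j`!%:R.
Proof.
have F m : m`!%:R != 0 :> R by rewrite pnatr_eq0 -lt0n fact_gt0.
rewrite coef_sum.
under eq_bigr => k _ do rewrite coefZ coefM mulr_sumr.
rewrite exchange_big /= (_ : 'X^2 - 'X = - ('X - 1) + ('X^2 - 1)); last by ring.
rewrite exprDn raddf_sum mulr_suml; apply: eq_bigr => i _ /=.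
rewrite raddfMn /= -[_ *+ 'C(j, i)]mulr_natl exprNn.
rewrite -[_ * _ * (_ ^+ i)]mulrA moment_signM mulrA.
rewrite (_ : ('X^2 - 1) ^+ i = (('X - 1) ^+ i) \Po 'X^2); last first.
  by rewrite rmorphXn rmorphB /= comp_polyX comp_polyC.
rewrite [in RHS]mulrAC -[0 in RHS](addr0 0) [X in moment _ _ X]mulrC.
rewrite momentM !mulr_sumr.
apply: eq_bigr => k _; rewrite moment_comp_sqr coef_comp_polyN.
rewrite !coef_bell_poly !stirling2_moment.
have -> : j`!%:R = 'C(j, i)%:R * i`!%:R * (j - i)`!%:R :> R.
  by rewrite -!natrM -mulnA bin_fact // -ltnS.
have B : 'C(j, i)%:R != 0 :> R by rewrite pnatr_eq0 -lt0n bin_gt0 -ltnS.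
by field; rewrite B !F.
Qed.

(** * The right side *)

(** The coefficient of u^k in u^j / (1 - u)^m. The predecessor truncated at 0
    gives the right value for m = 0 too: 1 if k = j and 0 otherwise. *)
Definition neg_bin m j k : nat :=
  if (j <= k)%N then 'C((m + (k - j)).-1, k - j) else 0.

(** Multiplication by 1 - u lowers the exponent of 1 / (1 - u). *)
Lemma neg_bin_pascal m j k :
  neg_bin m.+1 j k.+1 = (neg_bin m.+1 j k + neg_bin m j k.+1)%N.
Proof.
rewrite /neg_bin; case: (leqP j k) => jk.
  by rewrite (leqW jk) subSn // !addSn addnS /= binS addnC.
case: leqP => // jk1; have -> : j = k.+1 by lia.
by rewrite subnn !bin0.
Qed.

Lemma neg_bin0 m j : neg_bin m.+1 j 0 = neg_bin m j 0.
Proof. by rewrite /neg_bin sub0n !bin0. Qed.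

Lemma neg_bin_sumS m j n :
  'X * (\sum_(k < n.+1) (neg_bin m.+1 j k)%:R *: (1 - 'X) ^+ k) =
  \sum_(k < n.+1) (neg_bin m j k)%:R *: (1 - 'X) ^+ k
  - (neg_bin m.+1 j n)%:R *: (1 - 'X) ^+ n.+1 :> {poly R}.
Proof.
elim: n => [|n IH].
  by rewrite !big_ord1 neg_bin0 !expr0 expr1 -!mul_polyC; ring.
rewrite big_ord_recr [in RHS]big_ord_recr /= mulrDr IH.
rewrite neg_bin_pascal natrD -!mul_polyC !exprS polyCD; ring.
Qed.

(** With u = 1 - X, the truncation at order n of u^j / (1 - u)^m is congruent
    to u^j / X^m modulo u^(n+1). *)
Lemma neg_bin_dvdp m j n :
  ((1 - 'X) ^+ n.+1 : {poly R}) %|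
  'X^m * (\sum_(k < n.+1) (neg_bin m j k)%:R *: (1 - 'X) ^+ k) - (1 - 'X) ^+ j.
Proof.
elim: m => [|m IH].
  have E k : neg_bin 0 j k = (k == j).
    rewrite /neg_bin add0n; case: ltngtP => // jk; last by rewrite jk subnn.
    by rewrite bin_small // prednK ?subn_gt0.
  rewrite expr0 mul1r; case: (ltnP j n.+1) => jn.
    rewrite (bigD1 (Ordinal jn)) //= E eqxx scale1r big1 ?addr0 ?subrr ?dvdp0 //.
    move=> i ne; rewrite E (negPf (_ : i != j :> nat)) ?scale0r //.
  rewrite big1 ?sub0r ?dvdpNr ?dvdp_exp2l // => i _.
  by rewrite E ltn_eqF ?scale0r // (leq_trans (ltn_ord i)).
rewrite (exprSr 'X m) -mulrA neg_bin_sumS mulrBr addrAC dvdp_subr ?IH //.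
by rewrite dvdp_mull // -mul_polyC dvdp_mull.
Qed.

Lemma coef_J_poly n j :
  (J_poly R n)`_j = n`!%:R / j`!%:R * (neg_bin j.*2.+1 j n)%:R.
Proof.
rewrite /J_poly coefZ -(poly_def n.+1 (fun k => 'C(n + k, n - k)%:R / k`!%:R)).
rewrite coef_poly ltnS /neg_bin; case: leqP => jn; last by rewrite !mulr0.
have -> : (j.*2.+1 + (n - j)).-1 = (n + j)%N by lia.
by rewrite mulrA mulrAC.
Qed.

(** The factor 1 - u in the generating function of the L_k turns
    u^j / (1 - u)^(2j+1) into u^j / (1 - u)^(2j). *)
Lemma coef_L_poly n j :
  (L_poly R n)`_j = n`!%:R / j`!%:R * (neg_bin j.*2 j n)%:R.
Proof.
rewrite /L_poly coefB (coefZ n%:R) !coef_J_poly; case: n => [|n].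
  by rewrite mul0r subr0 neg_bin0.
by rewrite neg_bin_pascal natrD factS natrM /=; ring.
Qed.

(** Dividing by X^(2j) shifts the moment to -2j, where the reflection
    (1 - e^(-t))^j e^(2jt) = e^(jt) (e^t - 1)^j applies. *)
Lemma rhs_coef n j :
  (\sum_(k < n.+1) ((-1) ^+ (n - k) * stirling2 R n k) *: L_poly R k)`_j
  = moment 0 n (('X^2 - 'X) ^+ j) / j`!%:R.
Proof.
rewrite coef_sum.
transitivity ((-1) ^+ n * moment 0 n
    (\sum_(k < n.+1) (neg_bin j.*2 j k)%:R *: (1 - 'X) ^+ k) / j`!%:R).
  rewrite raddf_sum mulr_sumr mulr_suml; apply: eq_bigr => k _ /=.
  rewrite coefZ coef_L_poly stirling2_moment momentZ.
  rewrite -(opprB 'X 1) (exprNn ('X - 1)) moment_signM.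
  have -> : (-1) ^+ n = (-1) ^+ (n - k) * (-1) ^+ k :> R.
    by rewrite -exprD subnK // -ltnS.
  have F m : m`!%:R != 0 :> R by rewrite pnatr_eq0 -lt0n fact_gt0.
  have S : (-1) ^+ k * (-1) ^+ k = 1 :> R by rewrite -exprMn mulrNN mulr1 expr1n.
  (* The sign (-1)^(2k) = 1 is inserted, since field does not know it. *)
  rewrite -[LHS]mulr1 -[X in _ * X = _]S; field; by rewrite !F.
congr (_ / _).
rewrite -[0](addNr (j.*2)%:R) -momentXnM.
have /dvdpP[r /eqP] := neg_bin_dvdp j.*2 j n; rewrite subr_eq => /eqP ->.
rewrite raddfD /= (mulrC r) -(opprB 'X 1) (exprNn ('X - 1)).
rewrite -mulrA moment_signM moment_eq0 // mulr0 add0r opprB.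
rewrite moment_reflect opprK -addnn natrD addrK addNr.
rewrite (_ : 'X^2 - 'X = 'X * ('X - 1) :> {poly R}); last by ring.
by rewrite exprMn momentXnM add0r.
Qed.

End Moments.

Theorem theorem3p7 (R : realType) (n : nat) :
  \sum_(k < n.+1)
     ('C(n, k)%:R * 2 ^+ k) *: (bell_poly R k * (bell_poly R (n - k) \Po (- 'X)))
  = \sum_(k < n.+1) ((-1) ^+ (n - k) * stirling2 R n k) *: L_poly R k.
Proof. by apply/polyP => j; rewrite lhs_coef rhs_coef. Qed.
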